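(* Every simply-typed term of the $\lambda{\tt x}$-calculus is strongly normalizing: if $\Gamma\vdash t:A$ is derivable, then there is no infinite reduction sequence of the $\lambda{\tt x}$-calculus starting from $t$.
   Context: Terms of the $\lambda{\tt x}$-calculus: $t ::= x \mid (t\ t)\mid \lambda x.t\mid t[t/x]$, where $x$ is bound in $t$ in both $\lambda x.t$ and $t[u/x]$; terms are considered modulo $\alpha$-conversion. Reduction is the closure under all term contexts of the rules $(\lambda x.t)\,u\to t[u/x]$; $(t\ u)[v/x]\to (t[v/x])\ (u[v/x])$; $(\lambda x.t)[u/y]\to\lambda x.(t[u/y])$ (applied modulo $\alpha$-conversion of the bound variable $x$, avoiding capture); $x[t/x]\to t$; $y[t/x]\to y$ (for $y\neq x$). Simple types are built from atomic types with $\to$. Typing rules: $\Gamma,x:A\vdash x:A$; from $\Gamma\vdash u:B$ and $\Gamma,x:B\vdash t:A$ infer $\Gamma\vdash t[u/x]:A$; from $\Gamma\vdash t:B\to A$ and $\Gamma\vdash u:B$ infer $\Gamma\vdash (t\ u):A$; from $\Gamma,x:B\vdash t:A$ infer $\Gamma\vdash\lambda x.t:B\to A$. *)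

(* Defs.v *)
From mathcomp Require Import all_boot.
From mathcomp Require Import finmap.

Set Implicit Arguments.
Unset Strict Implicit.
Unset Printing Implicit Defensive.

Local Open Scope fset_scope.
Local Open Scope fmap_scope.

Definition var := nat.

(* [Sub t u x] is the explicit substitution t[u/x]: it binds [x] in [t] but
   not in [u].  [term] is the type of raw terms; identification up to
   alpha-conversion is built into the reduction [red] below. *)
Inductive term : Type :=
| Var (x : var)
| App (t u : term)
| Lam (x : var) (t : term)
| Sub (t u : term) (x : var).

Fixpoint fv (t : term) : {fset var} :=
  match t with
  | Var x => [fset x]
  | App t u => fv t `|` fv u
  | Lam x t => fv t `\ x
  | Sub t u x => (fv t `\ x) `|` fv u
  end.

(* All names occurring in a term: free, bound or binding. *)
Fixpoint names (t : term) : {fset var} :=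
  match t with
  | Var x => [fset x]
  | App t u => names t `|` names u
  | Lam x t => x |` names t
  | Sub t u x => x |` (names t `|` names u)
  end.

(* Replaces the free occurrences of [x] by [y]; only meaningful when [y] does
   not occur in the term, so that no capture can happen. *)
Fixpoint rename (x y : var) (t : term) : term :=
  match t with
  | Var z => Var (if z == x then y else z)
  | App t u => App (rename x y t) (rename x y u)
  | Lam z t => Lam z (if z == x then t else rename x y t)
  | Sub t u z => Sub (if z == x then t else rename x y t) (rename x y u) z
  end.

Inductive alpha : term -> term -> Prop :=
| alpha_lam x y t : y \notin names t ->
    alpha (Lam x t) (Lam y (rename x y t))
| alpha_sub x y t u : y \notin names t ->
    alpha (Sub t u x) (Sub (rename x y t) u y)
| alpha_refl t : alpha t t
| alpha_sym t t' : alpha t t' -> alpha t' t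
| alpha_trans t t' t'' : alpha t t' -> alpha t' t'' -> alpha t t''
| alpha_congr_app t t' u u' :
    alpha t t' -> alpha u u' -> alpha (App t u) (App t' u')
| alpha_congr_lam x t t' : alpha t t' -> alpha (Lam x t) (Lam x t')
| alpha_congr_sub x t t' u u' :
    alpha t t' -> alpha u u' -> alpha (Sub t u x) (Sub t' u' x).

Inductive step : term -> term -> Prop :=
| step_beta x t u : step (App (Lam x t) u) (Sub t u x)
| step_sub_app x t u v :
    step (Sub (App t u) v x) (App (Sub t v x) (Sub u v x))
| step_sub_lam x y t u : x != y -> x \notin fv u ->
    step (Sub (Lam x t) u y) (Lam x (Sub t u y))
| step_sub_var x t : step (Sub (Var x) t x) t
| step_sub_var_neq x y t : y != x -> step (Sub (Var y) t x) (Var y)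
| step_ctx_appl t t' u : step t t' -> step (App t u) (App t' u)
| step_ctx_appr t u u' : step u u' -> step (App t u) (App t u')
| step_ctx_lam x t t' : step t t' -> step (Lam x t) (Lam x t')
| step_ctx_subl x t t' u : step t t' -> step (Sub t u x) (Sub t' u x)
| step_ctx_subr x t u u' : step u u' -> step (Sub t u x) (Sub t u' x).

Definition red (t t' : term) : Prop :=
  exists s s', [/\ alpha t s, step s s' & alpha s' t'].

Inductive ty (atom : Type) : Type :=
| Atom (a : atom)
| Arrow (B A : ty atom).

(* [G.[x <- B]] overrides a declaration of [x] already in [G], which spares
   the side condition that bound variables be chosen outside [G]. *)
Inductive typing (atom : Type) :
    {fmap var -> ty atom} -> term -> ty atom -> Prop :=
| typing_var G x A : typing G.[x <- A] (Var x) A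
| typing_sub G x t u A B :
    typing G u B -> typing G.[x <- B] t A -> typing G (Sub t u x) A
| typing_app G t u A B :
    typing G t (Arrow B A) -> typing G u B -> typing G (App t u) A
| typing_lam G x t A B :
    typing G.[x <- B] t A -> typing G (Lam x t) (Arrow B A).

(* Main.v *)
From mathcomp Require Import all_boot.
From mathcomp Require Import finmap.
From mathcomp Require Import zify.
From Stdlib Require Import ClassicalEpsilon FunctionalExtensionality.
From Stdlib Require Import Eqdep.
Require Import Defs.

(** Terms are interpreted by strictly monotone functionals over [nat], with an
    extra natural number, the memory, that accounts for the sizes of all the
    closures in scope, garbage included: a variable consumes the memory, and
    [t[u/x]] is [t] evaluated where [x] is [u] and where the memory is
    increased by the value of [u].  Because every leaf of [t] thus already pays
    for [u], distributing a substitution leaves the interpretation unchanged,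
    erasing one can only make it smaller, and a beta step, even inside garbage,
    makes it strictly smaller.  The substitution rules alone terminate because
    they decrease a polynomial weight, so the pair (interpretation, weight)
    decreases lexicographically. *)

Set Implicit Arguments.
Unset Strict Implicit.
Unset Printing Implicit Defensive.

(** * Functionals *)

(** An argument is a function of the memory because each occurrence of a variable is evaluated with
    the memory found at that place. *)
Fixpoint dom (atom : Type) (A : ty atom) : Type :=
  match A with
  | Atom _ => nat
  | Arrow B A => (nat -> dom B) -> dom A
  end.

(* [rel k a b] means "[a + k <= b]", hereditarily; the elements with
   [rel 0 a a] are the strictly monotone functionals. *)
Fixpoint rel (atom : Type) (A : ty atom) (k : nat) : dom A -> dom A -> Prop :=
  match A with
  | Atom _ => fun a b => k + a <= b
  | Arrow B A => fun f g => forall j (d e : nat -> dom B),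
      (forall i m n, i + m <= n -> rel (i + j) (d m) (e n)) ->
      rel (k + j) (f d) (g e)
  end.

Definition rel_fun (atom : Type) (A : ty atom) (k : nat)
    (d e : nat -> dom A) : Prop :=
  forall i m n, i + m <= n -> rel (i + k) (d m) (e n).

Fixpoint incr (atom : Type) (A : ty atom) : dom A -> dom A :=
  match A with
  | Atom _ => S
  | Arrow _ _ => fun f d => incr (f d)
  end.

(** A strictly monotone constant of arrow type has to measure its argument, and a functional is
    measured by feeding it constants; hence the simultaneous recursion. *)
Fixpoint cst_norm (atom : Type) (A : ty atom) :
    (nat -> dom A) * (dom A -> nat) :=
  match A with
  | Atom _ => (id, id)
  | Arrow B A =>
      (fun n d => (cst_norm A).1 (n + (cst_norm B).2 (d 0)),
       fun f => (cst_norm A).2 (f (cst_norm B).1))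
  end.

Definition cst (atom : Type) (A : ty atom) : nat -> dom A := (cst_norm A).1.
Definition norm (atom : Type) (A : ty atom) : dom A -> nat := (cst_norm A).2.

Lemma rel_weaken (atom : Type) (A : ty atom) k l (a b : dom A) :
  l <= k -> rel k a b -> rel l a b.
Proof.
elim: A k l a b => [c|B _ A IH] k l a b lk /=; first by lia.
move=> ab j d e de; apply: IH (ab _ _ _ de); lia.
Qed.

Lemma rel_incr (atom : Type) (A : ty atom) k (a b : dom A) :
  rel k a b -> rel k (incr a) (incr b).
Proof.
elim: A k a b => [c|B _ A IH] k a b /=; first by lia.
by move=> ab j d e de; apply/IH/ab.
Qed.

Lemma rel_incrr (atom : Type) (A : ty atom) k (a b : dom A) :
  rel k a b -> rel k.+1 a (incr b).
Proof.
elim: A k a b => [c|B _ A IH] k a b /=; first by lia.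
by move=> ab j d e de; rewrite addSn; apply/IH/ab.
Qed.

Lemma rel_cst_norm (atom : Type) (A : ty atom) :
  rel_fun 0 (cst A) (cst A) /\
  forall k (a b : dom A), rel k a b -> k + norm a <= norm b.
Proof.
elim: A => [c|B [cB nB] A [cA nA]]; split => //=.
- by move=> i m n; rewrite addn0.
- move=> i m n imn j d e de.
  have /nB de0 := de 0 0 0 isT.
  apply: (@rel_weaken _ _ (i + j + 0)); first by lia.
  apply: cA; change (i + j + (m + norm (d 0)) <= n + norm (e 0)); lia.
- by move=> k f g /(_ 0 _ _ cB) /nA; rewrite addn0.
Qed.

Lemma rel_cst (atom : Type) (A : ty atom) : rel_fun 0 (cst A) (cst A).
Proof. by case: (rel_cst_norm A). Qed.

Lemma rel_norm (atom : Type) (A : ty atom) k (a b : dom A) :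
  rel k a b -> k + norm a <= norm b.
Proof. by case: (rel_cst_norm A) => _; apply. Qed.

(** * Environments *)

Definition upd (T : Type) (g : var -> T) (x : var) (v : T) : var -> T :=
  fun y => if y == x then v else g y.

Lemma upd_swap (T : Type) (g : var -> T) x y v w : x != y ->
  upd (upd g x v) y w = upd (upd g y w) x v.
Proof.
move=> xy; apply: functional_extensionality => z; rewrite /upd.
by case: (eqVneq z y) => // ->; rewrite eq_sym (negPf xy).
Qed.

Definition value (atom : Type) : Type := {A : ty atom & nat -> dom A}.

(* Junk value [cst A] when [v] does not have type [A]. *)
Definition cast (atom : Type) (v : value atom) (A : ty atom) : nat -> dom A :=
  match excluded_middle_informative (projT1 v = A) with
  | left p => eq_rect _ (fun A => nat -> dom A) (projT2 v) _ p
  | right _ => @cst atom A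
  end.

Lemma cast_existT (atom : Type) (A : ty atom) (d : nat -> dom A) :
  cast (existT _ A d) A = d.
Proof.
rewrite /cast; case: excluded_middle_informative => //= p.
by rewrite -Eq_rect_eq.eq_rect_eq.
Qed.

Notation env atom := (var -> value atom).

Definition rel_env (atom : Type) (r s : env atom) : Prop :=
  forall x A, rel_fun 0 (cast (r x) A) (cast (s x) A).

Lemma rel_env_upd (atom : Type) (r s : env atom) x A k (d e : nat -> dom A) :
  rel_env r s -> rel_fun k d e ->
  rel_env (upd r x (existT _ A d)) (upd s x (existT _ A e)).
Proof.
move=> rs de y B; rewrite /upd; case: eqP => // _.
rewrite /cast /=; case: excluded_middle_informative => [p|_].
  by case: B / p => i m n /de; apply: rel_weaken; lia.
exact: rel_cst.
Qed.

(** * Interpretation of terms *)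

Definition sem (atom : Type) (A : ty atom) : Type := env atom -> nat -> dom A.

Definition sem_var (atom : Type) (A : ty atom) (x : var) : sem A :=
  fun r m => cast (r x) A m.

(** [incr] charges the unit that a beta step gives back. The argument keeps the current memory [m]
    and adds to it the memory [n] of the place where it is used. *)
Definition sem_app (atom : Type) (A B : ty atom)
    (g : sem (Arrow B A)) (h : sem B) : sem A :=
  fun r m => incr (g r m (fun n => h r (m + n))).

Definition sem_lam (atom : Type) (A B : ty atom) (x : var)
    (g : sem A) : sem (Arrow B A) :=
  fun r m d => g (upd r x (existT _ B d)) (m + norm (d 0)).

(* The memory gets the value of [u] computed with an empty memory: the
   memory accumulated so far reaches [u] only through the occurrences of [x].
   This makes pushing a substitution under a lambda an equality. *)
Definition sem_sub (atom : Type) (A B : ty atom) (x : var)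
    (g : sem A) (h : sem B) : sem A :=
  fun r m => g (upd r x (existT _ B (h r))) (m + norm (h r 0)).

(* A relation and not a function of [t], because binders carry no types. *)
Fixpoint denotes (atom : Type) (G : var -> ty atom) (t : term)
    (A : ty atom) : sem A -> Prop :=
  match t with
  | Var x => fun f => G x = A /\ f = sem_var A x
  | App t u => fun f => exists B (g : sem (Arrow B A)) (h : sem B),
      [/\ denotes G t g, denotes G u h & f = sem_app g h]
  | Lam x t =>
      match A with
      | Atom _ => fun _ => False
      | Arrow B A => fun f => exists g : sem A,
          denotes (upd G x B) t g /\ f = sem_lam x g
      end
  | Sub t u x => fun f => exists B (g : sem A) (h : sem B),
      [/\ denotes (upd G x B) t g, denotes G u h & f = sem_sub x g h]
  end.

Lemma denotes_typing (atom : Type) (G : {fmap var -> ty atom}) t A :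
  typing G t A -> forall G' : var -> ty atom,
  (forall x B, (G.[? x])%fmap = Some B -> G' x = B) ->
  exists f : sem A, denotes G' t f.
Proof.
have ext (H : {fmap var -> ty atom}) (H' : var -> ty atom) x B :
    (forall y C, (H.[? y])%fmap = Some C -> H' y = C) ->
    forall y C, (H.[x <- B].[? y])%fmap = Some C -> upd H' x B y = C.
  by move=> HH y C; rewrite fnd_set /upd; case: eqP => [_ []|_ /HH].
elim=> {G t A} [G x A|G x t u A B _ IHu _ IHt|G t u A B _ IHt _ IHu
  |G x t A B _ IHt] G' GG'.
- exists (sem_var A x); split=> //; apply: GG'.
  by rewrite fnd_set eqxx.
- have [h Hh] := IHu _ GG'; have [g Hg] := IHt _ (ext _ _ x B GG').
  by exists (sem_sub x g h), B, g, h.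
- have [h Hh] := IHu _ GG'; have [g Hg] := IHt _ GG'.
  by exists (sem_app g h), B, g, h.
- have [g Hg] := IHt _ (ext _ _ x B GG').
  by exists (sem_lam x g), g.
Qed.

(** * Monotonicity *)

Definition rel_sem (atom : Type) (A : ty atom) (k : nat) (f g : sem A) : Prop :=
  forall r s, rel_env r s ->
  forall j m n, j + m <= n -> rel (k + j) (f r m) (g s n).

Lemma rel_sem_app (atom : Type) (A B : ty atom) k l
    (f g : sem (Arrow B A)) (f' g' : sem B) :
  rel_sem k f g -> rel_sem l f' g' ->
  rel_sem (k + l) (sem_app f f') (sem_app g g').
Proof.
move=> fg fg' r s rs j m n jmn; apply: rel_incr.
have H : rel_fun l (fun i => f' r (m + i)) (fun i => g' s (n + i)).
  by move=> i p q ipq; rewrite addnC; apply: fg' => //; lia.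
by have := fg r s rs j m n jmn l _ _ H; apply: rel_weaken; lia.
Qed.

Lemma rel_sem_lam (atom : Type) (A B : ty atom) k x (f g : sem A) :
  rel_sem k f g -> rel_sem k (sem_lam (B := B) x f) (sem_lam x g).
Proof.
move=> fg r s rs j m n jmn i d e de; rewrite -addnA; apply: fg.
  exact: rel_env_upd rs de.
(* The gap of the argument passes through the memory, so it survives even when [x] does not occur in
   the body. *)
by have /rel_norm := de 0 0 0 isT; lia.
Qed.

Lemma rel_sem_sub (atom : Type) (A B : ty atom) k l x
    (f g : sem A) (f' g' : sem B) :
  rel_sem k f g -> rel_sem l f' g' ->
  rel_sem (k + l) (sem_sub x f f') (sem_sub x g g').
Proof.
move=> fg fg' r s rs j m n jmn; rewrite -addnA; apply: fg.
  apply: (@rel_env_upd _ _ _ _ _ l) => // i p q ipq.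
  by rewrite addnC; apply: fg'.
by have /rel_norm := fg' r s rs 0 0 0 isT; lia.
Qed.

Lemma rel_sem_denotes (atom : Type) (G : var -> ty atom) t A (f : sem A) :
  denotes G t f -> rel_sem 0 f f.
Proof.
elim: t G A f => [x|t IHt u IHu|x t IHt|t IHt u IHu x] G A f /=.
- by case=> _ -> r s rs j m n jmn; rewrite addnC; apply: rs.
- by case=> B [g [h [/IHt Hg /IHu Hh ->]]]; apply: (rel_sem_app Hg Hh).
- by case: A f => // B A f [g [/IHt Hg ->]]; apply: rel_sem_lam.
- by case=> B [g [h [/IHt Hg /IHu Hh ->]]]; apply: (rel_sem_sub x Hg Hh).
Qed.

(** * Invariance under alpha-conversion *)

Definition bind (r : var -> var -> Prop) (x y a b : var) : Prop :=
  (a = x /\ b = y) \/ [/\ a != x, b != y & r a b].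

(* Alpha-equivalence of [t] and [t'] when their free variables are matched
   by [r]. *)
Fixpoint aeq (r : var -> var -> Prop) (t t' : term) : Prop :=
  match t, t' with
  | Var x, Var y => r x y
  | App t u, App t' u' => aeq r t t' /\ aeq r u u'
  | Lam x t, Lam y t' => aeq (bind r x y) t t'
  | Sub t u x, Sub t' u' y => aeq (bind r x y) t t' /\ aeq r u u'
  | _, _ => False
  end.

Lemma aeq_refl (r : var -> var -> Prop) t :
  (forall a, a \in fv t -> r a a) -> aeq r t t.
Proof.
have ext (s : var -> var -> Prop) x u :
    (forall a, a \in (fv u `\ x)%fset -> s a a) ->
    forall a, a \in fv u -> bind s x x a a.
  move=> H a au; case: (eqVneq a x) => ax; [by left|right; split=> //].
  by apply: H; rewrite in_fsetD1 ax.
elim: t r => [x|t IHt u IHu|x t IHt|t IHt u IHu x] r /= H.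
- by apply: H; rewrite in_fset1.
- by split; [apply: IHt|apply: IHu] => a au; apply: H; rewrite in_fsetU au ?orbT.
- by apply: IHt; apply: ext.
- split; [apply: IHt; apply: ext|apply: IHu] => a au;
    by apply: H; rewrite in_fsetU au ?orbT.
Qed.

Lemma aeq_sym (r s : var -> var -> Prop) t t' :
  (forall a b, r a b -> s b a) -> aeq r t t' -> aeq s t' t.
Proof.
have ext (r' s' : var -> var -> Prop) x y : (forall a b, r' a b -> s' b a) ->
    forall a b, bind r' x y a b -> bind s' y x b a.
  by move=> rs a b [[-> ->]|[? ? /rs]]; [left|right].
elim: t r s t' => [x|t IHt u IHu|x t IHt|t IHt u IHu x] r s [] //=.
- by move=> y rs /rs.
- by move=> t' u' rs [/(IHt _ _ _ rs) ? /(IHu _ _ _ rs)].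
- by move=> y t' rs; apply/IHt/ext.
- by move=> t' u' y rs [/(IHt _ _ _ (ext _ _ _ _ rs)) ? /(IHu _ _ _ rs)].
Qed.

Lemma fv_sub_names t : {subset fv t <= names t}.
Proof.
move=> a; elim: t => [x|t IHt u IHu|x t IHt|t IHt u IHu x] //=.
- by rewrite !in_fsetU => /orP[/IHt|/IHu] ->; rewrite ?orbT.
- by rewrite in_fsetD1 in_fset1U => /andP[_ /IHt] ->; rewrite orbT.
- rewrite in_fset1U !in_fsetU in_fsetD1.
  by move=> /orP[/andP[_ /IHt]|/IHu] ->; rewrite ?orbT.
Qed.

Lemma aeq_rename (r : var -> var -> Prop) x y t : y \notin names t ->
  (forall a, a \in fv t -> a != x -> r a a) -> r x y ->
  aeq r t (rename x y t).
Proof.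
have ext (s : var -> var -> Prop) z u :
    (y \notin names u -> forall s' : var -> var -> Prop,
      (forall a, a \in fv u -> a != x -> s' a a) -> s' x y ->
      aeq s' u (rename x y u)) ->
    y != z -> y \notin names u ->
    (forall a, a \in (fv u `\ z)%fset -> a != x -> s a a) -> s x y ->
    aeq (bind s z z) u (if z == x then u else rename x y u).
  (* If the binder shadows [x], the renaming stops and both bodies are the same term. *)
  move=> IH yz yu H sxy; case: (eqVneq z x) => [zx|zx].
    apply: aeq_refl => a au; case: (eqVneq a z) => az; [by left|right].
    by split=> //; apply: H; rewrite ?in_fsetD1 ?az // -zx.
  apply: IH => //; last by right; rewrite eq_sym.
  move=> a au ax; case: (eqVneq a z) => az; [by left|right; split=> //].
  by apply: H; rewrite // in_fsetD1 az.
elim: t r => [z|t IHt u IHu|z t IHt|t IHt u IHu z] r /=.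
- by move=> _ H rxy; case: (eqVneq z x) => [->|] //; apply: H; rewrite in_fset1.
- rewrite in_fsetU negb_or => /andP[yt yu] H rxy.
  by split; [apply: IHt|apply: IHu] => // a au; apply: H;
    rewrite in_fsetU au ?orbT.
- rewrite in_fset1U negb_or => /andP[yz yt] H rxy.
  by apply: ext => // _ s; apply: IHt.
- rewrite in_fset1U in_fsetU !negb_or => /and3P[yz yt yu] H rxy; split.
    apply: ext => // [_ s|a au]; first exact: IHt.
    by apply: H; rewrite in_fsetU au.
  by apply: IHu => // a au; apply: H; rewrite in_fsetU au orbT.
Qed.

(** The general [r] serves twice: equality gives invariance under alpha-conversion, and equality
    restricted to the free variables of a term gives weakening. *)
Lemma denotes_aeq (atom : Type) (r : var -> var -> Prop) t t'
    (G G' : var -> ty atom) A (f : sem A) :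
  aeq r t t' -> (forall a b, r a b -> G a = G' b) -> denotes G t f ->
  exists f' : sem A, denotes G' t' f' /\
    forall s s', (forall a b, r a b -> s a = s' b) -> f s = f' s'.
Proof.
have ext T (r' : var -> var -> Prop) x y (g h : var -> T) v :
    (forall a b, r' a b -> g a = h b) ->
    forall a b, bind r' x y a b -> upd g x v a = upd h y v b.
  move=> H a b [[-> ->]|[ax b_y /H]]; first by rewrite /upd !eqxx.
  by rewrite /upd (negPf ax) (negPf b_y).
elim: t r t' G G' A f => [x|t IHt u IHu|x t IHt|t IHt u IHu x] r [] //=.
- move=> y G G' A f rxy GG' [Gx ->]; exists (sem_var A y).
  split; first by rewrite -(GG' _ _ rxy).
  by move=> s s' ss'; rewrite /sem_var (ss' _ _ rxy).
- move=> t' u' G G' A f [tt' uu'] GG' [B [g [h [Hg Hh ->]]]].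
  have [g' [Hg' gg']] := IHt _ _ _ _ _ _ tt' GG' Hg.
  have [h' [Hh' hh']] := IHu _ _ _ _ _ _ uu' GG' Hh.
  exists (sem_app g' h'); split; first by exists B, g', h'.
  by move=> s s' ss'; rewrite /sem_app (gg' _ _ ss') (hh' _ _ ss').
- move=> y t' G G' [//|B A] f tt' GG' [g [Hg ->]].
  have [g' [Hg' gg']] := IHt _ _ _ _ _ _ tt' (ext _ _ _ _ _ _ B GG') Hg.
  exists (sem_lam y g'); split; first by exists g'.
  move=> s s' ss'; rewrite /sem_lam.
  apply: functional_extensionality => m; apply: functional_extensionality => d.
  by rewrite (gg' _ _ (ext _ _ _ _ _ _ _ ss')).
- move=> t' u' y G G' A f [tt' uu'] GG' [B [g [h [Hg Hh ->]]]].
  have [g' [Hg' gg']] := IHt _ _ _ _ _ _ tt' (ext _ _ _ _ _ _ B GG') Hg.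
  have [h' [Hh' hh']] := IHu _ _ _ _ _ _ uu' GG' Hh.
  exists (sem_sub y g' h'); split; first by exists B, g', h'.
  move=> s s' ss'; rewrite /sem_sub (hh' _ _ ss').
  by rewrite (gg' _ _ (ext _ _ _ _ _ _ _ ss')).
Qed.

Lemma denotes_aeq_eq (atom : Type) t t' (G : var -> ty atom) A (f : sem A) :
  aeq eq t t' -> denotes G t f -> denotes G t' f.
Proof.
move=> tt' Hf; have [|f' [Hf' ff']] := denotes_aeq tt' _ Hf (G' := G).
  by move=> a b ->.
suff -> : f = f' by [].
by apply: functional_extensionality => s; apply: ff' => a b ->.
Qed.

(** With an equivalence as conclusion, symmetry and transitivity are immediate, and [aeq] is needed
    only for the two renaming rules. *)
Lemma denotes_alpha (atom : Type) t t' : alpha t t' ->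
  forall (G : var -> ty atom) A (f : sem A), denotes G t f <-> denotes G t' f.
Proof.
have eqC t1 t2 : aeq eq t1 t2 ->
    forall (G : var -> ty atom) A (f : sem A),
    denotes G t1 f <-> denotes G t2 f.
  move=> t12 G A f; split; apply: denotes_aeq_eq => //.
  by apply: aeq_sym t12.
have fresh x y u : y \notin names u -> aeq (bind eq x y) u (rename x y u).
  move=> yu; apply: aeq_rename => //; last by left.
  move=> a au ax; right; split=> //.
  by apply: contraNneq yu => <-; apply: fv_sub_names.
elim=> {t t'}.
- by move=> x y t yt; apply: eqC; apply: fresh.
- move=> x y t u yt; apply: eqC; split; first exact: fresh.
  exact: aeq_refl.
- by [].
- by move=> t t' _ IH G A f; rewrite IH.
- by move=> t t' t'' _ IH _ IH' G A f; rewrite IH.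
- move=> t t' u u' _ IHt _ IHu G A f /=.
  by split=> -[B [g [h [/IHt Hg /IHu Hh ->]]]]; exists B, g, h.
- move=> x t t' _ IHt G [//|B A] f /=.
  by split=> -[g [/IHt Hg ->]]; exists g.
- move=> x t t' u u' _ IHt _ IHu G A f /=.
  by split=> -[B [g [h [/IHt Hg /IHu Hh ->]]]]; exists B, g, h.
Qed.

(** * Decrease along reductions *)

(** The product makes [t] pay for [u] at each of its nodes, so distributing a substitution saves the
    copy charged to the node it crosses. *)
Fixpoint weight (t : term) : nat :=
  match t with
  | Var _ => 1
  | App t u => (weight t + weight u).+1
  | Lam _ t => (weight t).+1
  | Sub t u _ => weight t * (weight u).+1
  end.

Lemma weight_gt0 t : 0 < weight t.
Proof. by elim: t => //= t IHt u IHu _; rewrite muln_gt0 IHt. Qed.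

Lemma weight_rename x y t : weight (rename x y t) = weight t.
Proof.
elim: t => [z|t IHt u IHu|z t IHt|t IHt u IHu z] //=; rewrite ?IHt ?IHu //.
- by case: ifP; rewrite ?IHt.
- by case: ifP; rewrite ?IHt.
Qed.

Lemma weight_alpha t t' : alpha t t' -> weight t = weight t'.
Proof.
elim=> {t t'} //= *; rewrite ?weight_rename //; congruence.
Qed.

(** Subject reduction and decrease go together. A beta step gives [k = 1] and may raise the weight;
    the substitution rules give [k = 0] and lower it. Contexts preserve either alternative. *)
Lemma denotes_step (atom : Type) t t' : step t t' ->
  forall (G : var -> ty atom) A (f : sem A), denotes G t f ->
  exists k (f' : sem A),
    [/\ denotes G t' f', rel_sem k f' f & 0 < k \/ weight t' < weight t].
Proof.
elim=> {t t'}.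
- move=> x t u G A f /= [B [_ [h [[g [Hg ->]] Hh ->]]]].
  exists 1, (sem_sub x g h); split; [by exists B, g, h| |by left].
  (* The outer [incr] yields the unit. What remains is monotonicity of [g]: the application reads
     [h] at memories larger by [n] than the substitution does. *)
  move=> r s rs j m n jmn; apply: rel_incrr; apply: (rel_sem_denotes Hg).
    apply: (@rel_env_upd _ _ _ _ _ 0) => // i p q ipq.
    by rewrite addnC; apply: (rel_sem_denotes Hh) => //; lia.
  by have /rel_norm := rel_sem_denotes Hh rs (j := 0) (leq0n (n + 0)); lia.
- move=> x t u v G A f Hf.
  exists 0, f; split; [|exact: rel_sem_denotes Hf|].
    case: Hf => C [_ [h [[B [g1 [g2 [Hg1 Hg2 ->]]]] Hh ->]]].
    exists B, (sem_sub x g1 h), (sem_sub x g2 h).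
    split; [by exists C, g1, h|by exists C, g2, h|].
    (* The two sides differ only in the order in which the memories are added. *)
    apply: functional_extensionality => r; apply: functional_extensionality => m.
    rewrite /sem_app /sem_sub; congr (incr (g1 _ _ _)).
    by apply: functional_extensionality => n; rewrite addnAC.
  by right => /=; have := weight_gt0 v; nia.
- move=> x y t u xy xu G A f Hf.
  exists 0, f; split; [|exact: rel_sem_denotes Hf|].
    case: Hf => B [g0 [h []]] /=; case: A f g0 => // C A f _ [g [Hg ->]] Hh ->.
    (* [u] moves under the binder of [x]; as [x] is not free in it, matching on [fv u] alone
       transports its denotation. *)
    have [||h' [Hh' hh']] :=
      denotes_aeq (r := fun a b => a = b /\ a \in fv u) (t' := u)
        (G' := upd G x C) _ _ Hh.
    + by apply: aeq_refl.
    + by move=> a _ [<- au]; rewrite /upd; case: eqP => // ax;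
        rewrite -ax au in xu.
    exists (sem_sub y g h'); split.
      by exists B, g, h'; rewrite upd_swap.
    apply: functional_extensionality => r; apply: functional_extensionality => m.
    apply: functional_extensionality => d; rewrite /sem_lam /sem_sub.
    rewrite -(hh' r); last first.
      move=> a _ [<- au]; rewrite /upd; case: eqP => // ax.
      by rewrite -ax au in xu.
    by rewrite upd_swap 1?eq_sym // addnAC.
  by right => /=; have := weight_gt0 u; nia.
- move=> x t G A f /= [B [g [h [[BA ->] Hh ->]]]].
  rewrite /upd eqxx in BA; case: A / BA f g => _ _.
  exists 0, h; split=> //; last by right; lia.
  (* The redex is [h] at a memory increased by the norm of [h]. That norm may be zero, so strictness
     has to come from the weight. *)
  move=> r s rs j m n jmn; rewrite /sem_sub /sem_var /upd eqxx cast_existT.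
  by apply: (rel_sem_denotes Hh) => //; lia.
- move=> x y t yx G A f /= [B [g [h [[Gy ->] Hh ->]]]].
  rewrite /upd (negPf yx) in Gy.
  exists 0, (sem_var A y); split=> //; last first.
    by right; have := weight_gt0 t; lia.
  move=> r s rs j m n jmn; rewrite /sem_sub /sem_var /upd (negPf yx) addnC.
  by apply: rs; lia.
- move=> t t' u _ IH G A f /= [B [g [h [Hg Hh ->]]]].
  have [k [g' [Hg' gg' kw]]] := IH _ _ _ Hg.
  exists k, (sem_app g' h); split; [by exists B, g', h| |by lia].
  by rewrite -[k]addn0; apply: rel_sem_app => //; apply: rel_sem_denotes Hh.
- move=> t u u' _ IH G A f /= [B [g [h [Hg Hh ->]]]].
  have [k [h' [Hh' hh' kw]]] := IH _ _ _ Hh.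
  exists k, (sem_app g h'); split; [by exists B, g, h'| |by lia].
  by apply: (rel_sem_app (k := 0)) => //; apply: rel_sem_denotes Hg.
- move=> x t t' _ IH G [//|B A] f /= [g [Hg ->]].
  have [k [g' [Hg' gg' kw]]] := IH _ _ _ Hg.
  exists k, (sem_lam x g'); split; [by exists g'| |by lia].
  exact: rel_sem_lam.
- move=> x t t' u _ IH G A f /= [B [g [h [Hg Hh ->]]]].
  have [k [g' [Hg' gg' kw]]] := IH _ _ _ Hg.
  exists k, (sem_sub x g' h); split; [by exists B, g', h| |by nia].
  by rewrite -[k]addn0; apply: rel_sem_sub => //; apply: rel_sem_denotes Hh.
- move=> x t u u' _ IH G A f /= [B [g [h [Hg Hh ->]]]].
  have [k [h' [Hh' hh' kw]]] := IH _ _ _ Hh.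
  exists k, (sem_sub x g h'); split; [by exists B, g, h'| |].
    by apply: (rel_sem_sub (k := 0)) => //; apply: rel_sem_denotes Hg.
  by have := weight_gt0 t; nia.
Qed.

Lemma denotes_red (atom : Type) t t' (G : var -> ty atom) A (f : sem A) :
  red t t' -> denotes G t f ->
  exists k (f' : sem A),
    [/\ denotes G t' f', rel_sem k f' f & 0 < k \/ weight t' < weight t].
Proof.
case=> s [s' [ts ss' st']] /(denotes_alpha ts) Hf.
have [k [f' [Hf' ff' kw]]] := denotes_step ss' Hf.
exists k, f'; split=> //; first exact/(denotes_alpha st').
by rewrite (weight_alpha ts) -(weight_alpha st').
Qed.

Lemma denotes_terminates (atom : Type) (G : var -> ty atom) A (f : sem A)
    (s : nat -> term) :
  (forall n, red (s n) (s n.+1)) -> ~ denotes G (s 0) f.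
Proof.
(* Any environment related to itself would do; it turns a functional into a number through
   [norm]. *)
pose r0 : env atom := fun=> existT _ A (@cst atom A).
have r0r0 : rel_env r0 r0.
  by move=> x B; rewrite /cast; case: excluded_middle_informative => [p|_];
    [case: B / p|]; apply: rel_cst.
have [N fN] := ubnP (norm (f r0 0)).
elim: N f s fN => // N IHN f s fN.
have [W sW] := ubnP (weight (s 0)).
elim: W f s fN sW => // W IHW f s fN sW Hs Hf.
have [k [f' [Hf' ff' kw]]] := denotes_red (Hs 0) Hf.
have /rel_norm ff0 := ff' _ _ r0r0 0 0 0 isT.
have Hs' n : red (s n.+1) (s n.+2) by [].
(* Either the norm drops, whatever the new weight, or the norm does not grow and the weight
   drops. *)
case: kw => kw.
- by apply: (IHN f' (fun n => s n.+1)) => //; lia.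
- by apply: (IHW f' (fun n => s n.+1)) => //; lia.
Qed.

Theorem corollary3p2 (atom : Type) (G : {fmap var -> ty atom}) (t : term)
    (A : ty atom) (ht : typing G t A) :
  ~ exists f : nat -> term, f 0 = t /\ forall n : nat, red (f n) (f n.+1).
Proof.
case=> s [s0 Hs].
(* Contexts of [denotes] are total, so undeclared variables get the arbitrary type [A]. *)
have [|f Hf] := denotes_typing ht (G' := fun x => odflt A (G.[? x])%fmap).
  by move=> x B ->.
by rewrite -s0 in Hf; apply: denotes_terminates Hs Hf.
Qed.
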